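(* (i) For all integers $m\ge1$, $k\ge1$ and every $\pi\in\mathrm{Evil}(m,k)$: $\psi_p(\pi)=f^{-1}\big(P^{-1}(\Psi_1(P(f(\pi))))\big)$, where $\Psi_1:\mathrm{ParSeq}(m+1,k)\to\mathrm{ParSeq}(m+2,k)$. (ii) For all integers $m\ge1$, $k\ge1$ and every $\pi\in\mathrm{Evil}(m,k)$: $\psi_q(\pi)=f^{-1}\big(P^{-1}(\Psi_2(P(f(\pi))))\big)$, where $\Psi_2:\mathrm{ParSeq}(m+1,k)\to\mathrm{ParSeq}(m+2,k)$. (iii) For all integers $k\ge1$, $n$, $i$ with $k+1\le i\le n-1$ and every $\pi\in\mathrm{Evil}(i-1,k-1)$: $\psi_{i,k,n}(\pi)=f^{-1}\big(P^{-1}(\Phi_{i,k,n}(P(f(\pi))))\big)$.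
   Context: Permutations are in one-line form. A permutation is evil-avoiding if it avoids $2413,4132,4213,3214$; a recoil of $\pi\in S_n$ is $i$ with $\pi^{-1}_i>\pi^{-1}_{i+1}$. $\mathrm{Evil}(m,k)$ is the set of evil-avoiding permutations in $S_m$ with $k$ recoils, and $\mathrm{St}(n,k)$ the set of evil-avoiding $\pi\in S_n$ with $\pi_1=1$ and $k$ recoils. $f(\pi)=[1,\pi_1+1,\dots,\pi_m+1]$ for $\pi\in S_m$; $f$ is a bijection $\mathrm{Evil}(m,k)\to\mathrm{St}(m+1,k)$. Operators: $\rho_{i,j}(\pi)\in S_{n+1}$ (for $\pi\in S_n$) increases every entry $\ge i$ by $1$ and inserts value $i$ at position $j$; $\gamma_{a,b}(\pi)$ ($a>b$) moves the entry at position $a$ to position $b$. $\psi_p=\rho_{1,1}$. For non-identity evil-avoiding $\pi\in S_n$ with smallest recoil $t$: $\pi$ is $(a,b)$-sandwiched ($a\ge0,b\ge1$) if $(\pi_1,\dots,\pi_a)=(1,\dots,a)$ and $(\pi_{n-b+1},\dots,\pi_n)=(a+1,\dots,a+b)$; $\psi_q(\pi)=\gamma_{n-b+2,a+2}(\rho_{t+1,1}(\pi))$ if $\pi$ is $(a,b)$-sandwiched, else $\psi_q(\pi)=\rho_{t+1,1}(\pi)$. For $\pi\in S_{i-1}$, $\psi_{i,k,n}(\pi)=[\pi_1+n-i,\dots,\pi_{i-1}+n-i,1,2,\dots,n-i]\in S_{n-1}$. The Lehmer code of $\sigma\in S_n$ is $(c_1,\dots,c_n)$ with $c_i=|\{j>i:\sigma_j<\sigma_i\}|$.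 A partition is a weakly decreasing tuple of nonnegative integers (trailing zeros may be dropped); its length is the number of nonzero parts. A partition $\lambda$ is valid for $n$ if it is contained in a $\mathrm{length}(\lambda)\times(n-\mathrm{length}(\lambda))$ rectangle and is neither empty nor the whole rectangle. For $1\le k\le n-2$, $\mathrm{ParSeq}(n,k)$ is the set of sequences $(\lambda^1,\dots,\lambda^k)$ of partitions valid for $n$ such that for $1\le i\le k-1$, if $\ell$ is the smallest part of $\lambda^i$ then the first $n-\ell$ parts of $\lambda^{i+1}$ are equal; $\mathrm{ParSeq}(n,0)$ consists of the empty sequence. $P:\mathrm{St}(n,k)\to\mathrm{ParSeq}(n,k)$ is the bijection (due to Kim–Williams) defined as follows: let $c=(c_1,\dots,c_n)$ be the Lehmer code of $\pi^{-1}$, let $a_1<\dots<a_k$ be the positions $i$ with $c_i>c_{i+1}$, $a_0=0$, and set $\lambda^i=(n-a_i,\dots,n-a_i)-(0,\dots,0,c_{a_{i-1}+1},\dots,c_{a_i})$ (both tuples of length $a_i$, the second with $a_{i-1}$ leading zeros, subtraction coordinatewise); $P(\pi)=(\lambda^1,\dots,\lambda^k)$. For $k\ge1$, $\Psi_1:\mathrm{ParSeq}(n-1,k)\to\mathrm{ParSeq}(n,k)$ duplicates the first part of every $\lambda^i$. $\Psi_2:\mathrm{ParSeq}(n-1,k)\to\mathrm{ParSeq}(n,k)$ duplicates the first part of each $\lambda^i$ for $i\ge2$, and replaces $\lambda^1=(\lambda^1_1,\dots,\lambda^1_r)$ by $(\lambda^1_1+1,\lambda^1_1,\dots,\lambda^1_r)$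 if all its parts are equal, and by $(\lambda^1_1+1,\lambda^1_2,\dots,\lambda^1_r)$ otherwise. For $k+1\le i\le n-1$, $\Phi_{i,k,n}:\mathrm{ParSeq}(i,k-1)\to\mathrm{ParSeq}(n,k)$ sends $(\lambda^1,\dots,\lambda^{k-1})$ to $((i-1),\mu^1,\dots,\mu^{k-1})$, where $\mu^j$ is $\lambda^j$ with its first part duplicated $n-i$ times. *)

(* Defs.v *)
(* Permutations of S_n are represented in one-line form as
   sequences of natural numbers (values 1..n); partitions as seq nat with
   trailing zeros removed; partition sequences as seq (seq nat). *)
From mathcomp Require Import all_boot.
Set Implicit Arguments. Unset Strict Implicit. Unset Printing Implicit Defensive.

Definition is_perm (n : nat) (s : seq nat) : bool := perm_eq s (iota 1 n).

Fixpoint subseqs_k (k : nat) (s : seq nat) : seq (seq nat) :=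
  match s with
  | [::] => if k is 0 then [:: [::]] else [::]
  | x :: s' => (if k is k'.+1 then map (cons x) (subseqs_k k' s') else [::])
               ++ subseqs_k k s'
  end.

Definition order_iso (t p : seq nat) : bool :=
  (size t == size p) &&
  all (fun i => all (fun j => (nth 0 t i < nth 0 t j) == (nth 0 p i < nth 0 p j))
                    (iota 0 (size p))) (iota 0 (size p)).

Definition contains (s p : seq nat) : bool :=
  has (fun t => order_iso t p) (subseqs_k (size p) s).

Definition avoids (s p : seq nat) : bool := ~~ contains s p.

Definition evil_avoiding (s : seq nat) : bool :=
  [&& avoids s [:: 2; 4; 1; 3], avoids s [:: 4; 1; 3; 2],
      avoids s [:: 4; 2; 1; 3] & avoids s [:: 3; 2; 1; 4]].

(* position (0-based) of value v in s; pi^{-1}_v = pos v + 1 *)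
Definition pos (s : seq nat) (v : nat) : nat := index v s.

Definition recoils (s : seq nat) : seq nat :=
  [seq i <- iota 1 (size s).-1 | pos s i.+1 < pos s i].

Definition nrecoils (s : seq nat) : nat := size (recoils s).

Definition Evil (m k : nat) (s : seq nat) : bool :=
  [&& is_perm m s, evil_avoiding s & nrecoils s == k].

Definition St (n k : nat) (s : seq nat) : bool :=
  [&& is_perm n s, evil_avoiding s, head 0 s == 1 & nrecoils s == k].

Definition f (s : seq nat) : seq nat := 1 :: map S s.
Definition f_inv (s : seq nat) : seq nat := map predn (behead s).

(* rho_{i,j}: increase entries >= i by one and insert value i at (1-based) position j *)
Definition rho (i j : nat) (s : seq nat) : seq nat :=
  let s' := map (fun x => if i <= x then x.+1 else x) s in
  take j.-1 s' ++ i :: drop j.-1 s'.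

(* gamma_{a,b} (a > b): move entry at (1-based) position a to position b *)
Definition gamma (a b : nat) (s : seq nat) : seq nat :=
  let x := nth 0 s a.-1 in
  let s' := take a.-1 s ++ drop a s in
  take b.-1 s' ++ x :: drop b.-1 s'.

Definition psi_p (s : seq nat) : seq nat := rho 1 1 s.

Definition sandwiched (s : seq nat) (a b : nat) : bool :=
  [&& 1 <= b, take a s == iota 1 a & drop (size s - b) s == iota a.+1 b]
  && (a + b <= size s).

Definition smallest_recoil (s : seq nat) : nat := head 0 (recoils s).

Definition psi_q (s : seq nat) : seq nat :=
  let n := size s in
  let t := smallest_recoil s in
  let r := rho t.+1 1 s in
  match [seq ab <- [seq (a, b) | a <- iota 0 n.+1, b <- iota 1 n] | sandwiched s ab.1 ab.2] with
  | (a, b) :: _ => gamma (n - b + 2) (a + 2) r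
  | [::] => r
  end.

Definition psi_ikn (i k n : nat) (s : seq nat) : seq nat :=
  map (fun x => x + (n - i)) s ++ iota 1 (n - i).

Definition perm_inv (s : seq nat) : seq nat :=
  [seq (pos s v).+1 | v <- iota 1 (size s)].

(* Lehmer code (c_1,...,c_n), stored 0-indexed *)
Definition lehmer (s : seq nat) : seq nat :=
  [seq count (fun y => y < nth 0 s i) (drop i.+1 s) | i <- iota 0 (size s)].

Definition strip0 (l : seq nat) : seq nat :=
  rev (drop (find (fun x => x != 0) (rev l)) (rev l)).

Definition Pmap (s : seq nat) : seq (seq nat) :=
  let n := size s in
  let c := lehmer (perm_inv s) in
  let A := [seq i <- iota 1 n | nth 0 c i < nth 0 c i.-1] in   (* c_i > c_{i+1} *)
  let A0 := 0 :: A in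
  [seq strip0 (mkseq (fun j => (n - nth 0 A l) -
                       (if j < nth 0 A0 l then 0 else nth 0 c j)) (nth 0 A l))
  | l <- iota 0 (size A)].

Definition St_list (n k : nat) : seq (seq nat) :=
  [seq s <- permutations (iota 1 n) | St n k s].

Definition P_inv (n k : nat) (X : seq (seq nat)) : seq nat :=
  nth [::] (St_list n k) (find (fun s => Pmap s == X) (St_list n k)).

Definition dup_first (l : seq nat) : seq nat :=
  if l is x :: _ then x :: l else l.

Definition Psi1 (X : seq (seq nat)) : seq (seq nat) := map dup_first X.

Definition psi2_first (l : seq nat) : seq nat :=
  match l with
  | x :: r => if all (fun y => y == x) r then x.+1 :: x :: r else x.+1 :: r
  | [::] => [::]
  end.

Definition Psi2 (X : seq (seq nat)) : seq (seq nat) :=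
  match X with
  | l1 :: rest => psi2_first l1 :: map dup_first rest
  | [::] => [::]
  end.

Definition dup_first_n (d : nat) (l : seq nat) : seq nat :=
  if l is x :: _ then nseq d x ++ l else l.

Definition Phi (i k n : nat) (X : seq (seq nat)) : seq (seq nat) :=
  [:: i.-1] :: map (dup_first_n (n - i)) X.

(* Main.v *)
Require Import Defs.
From mathcomp Require Import all_boot zify.
Set Implicit Arguments. Unset Strict Implicit. Unset Printing Implicit Defensive.

(** The Lehmer code of the inverse of [s] lists, for each value [v], the number
    of larger entries to the left of [v].  It determines [s], its descents are
    the recoils of [s], and passing from [s] to [f s] prepends [0] to it.  As
    [P] cuts this code at its descents and the entries of a block are bounded by
    the amount [n - a_i] from which they are subtracted, [P] is injective on
    permutations starting with 1.  So it suffices to check that the three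
    operators preserve evil-avoidance and to follow the code [c] of [s].  The
    operator psi_p prepends [0] to [c], and psi_(i,k,n) prepends [n - i] copies
    of [i - 1].  If [c1] is the part of [c] up to its first descent [t], then
    rho_(t+1,1) adds one to the entries of [c1] and inserts [0] after it; the
    result differs from Psi_2 exactly when [c1] only has the extreme values [0]
    and [m - t], which is the sandwiched case, and gamma repairs it. *)

(** * The code of a permutation and its partition sequence *)

Definition larger_before (v : nat) (s : seq nat) : nat :=
  count (ltn v) (take (index v s) s).

Definition code (s : seq nat) : seq nat :=
  [seq larger_before v s | v <- iota 1 (size s)].

(** Positions are one-based while the list is zero-based, so [i] compares $c_i$ with $c_{i+1}$. The
    default [0] past the end makes [size c] a descent as soon as the last entry is positive. *)
Definition descents (c : seq nat) : seq nat :=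
  [seq i <- iota 1 (size c) | nth 0 c i < nth 0 c i.-1].

Definition masked (m : nat) (c : seq nat) (j : nat) : nat :=
  if j < m then 0 else nth 0 c j.

Definition part (n : nat) (c : seq nat) (m a : nat) : seq nat :=
  strip0 (mkseq (fun j => n - a - masked m c j) a).

(** [pairmap] runs through the pairs $(a_{i-1}, a_i)$ of consecutive descents, its start [0] being
    $a_0$. *)
Definition code_parts (n : nat) (c : seq nat) : seq (seq nat) :=
  pairmap (part n c) 0 (descents c).

Lemma larger_before_cons v x s :
  larger_before v (x :: s) = if x == v then 0 else (v < x) + larger_before v s.
Proof. by rewrite /larger_before /=; case: eqP. Qed.

Lemma larger_before_cat v s1 s2 :
  larger_before v (s1 ++ s2) =
  if v \in s1 then larger_before v s1 else count (ltn v) s1 + larger_before v s2.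
Proof.
elim: s1 => [|x s IH] //=; rewrite !larger_before_cons inE eq_sym IH.
by case: eqP => //= _; case: ifP => // _; rewrite addnA.
Qed.

Lemma larger_before_map g v s : {mono g : x y / x < y} ->
  larger_before (g v) (map g s) = larger_before v s.
Proof.
move=> mg; elim: s => [|x s IH] //=; rewrite !larger_before_cons IH mg.
suff -> : (g x == g v) = (x == v) by [].
by move: (mg x v) (mg v x); lia.
Qed.

(** No value lies strictly between [i] and [i.+1]. If [i.+1] comes first, then it and everything
    counted for it are counted for [i]; otherwise everything counted for [i] is also counted for
    [i.+1]. *)
Lemma larger_before_succ i s :
  (larger_before i.+1 s < larger_before i s) = (index i.+1 s < index i s).
Proof.
elim: s => [|x s IH] //=; rewrite !larger_before_cons.
case: (x =P i) => [->|ni]; first by case: eqP; rewrite ?ltn0.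
by case: (x =P i.+1) => [->|nSi]; lia.
Qed.

Lemma size_code s : size (code s) = size s.
Proof. by rewrite size_map size_iota. Qed.

Lemma is_perm_size n s : is_perm n s -> size s = n.
Proof. by move/perm_size; rewrite size_iota. Qed.

Lemma is_perm_uniq n s : is_perm n s -> uniq s.
Proof. by move/perm_uniq ->; rewrite iota_uniq. Qed.

Lemma is_perm_mem n s v : is_perm n s -> (v \in s) = (1 <= v <= n).
Proof. by move/perm_mem ->; rewrite mem_iota add1n ltnS. Qed.

Lemma count_gt_iota v k n : count (ltn v) (iota k n) = n - (v.+1 - k).
Proof. by elim: n k => [|n IH] k //=; rewrite IH; lia. Qed.

Lemma larger_before_bound n s v : is_perm n s -> larger_before v s <= n - v.
Proof.
move=> ps; have -> : n - v = count (ltn v) s.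
  by rewrite (permP ps) count_gt_iota; lia.
by rewrite -{2}(cat_take_drop (index v s) s) count_cat leq_addr.
Qed.

Lemma nth_code s j :
  nth 0 (code s) j = if j < size s then larger_before j.+1 s else 0.
Proof.
case: ltnP => h; last by rewrite nth_default // size_code.
by rewrite (nth_map 0) ?size_iota // nth_iota // add1n.
Qed.

(** Both sides count the values [u > v] standing to the left of [v]: the Lehmer code of the inverse
    lists them by value, [larger_before] by position. *)
Lemma lehmer_inv n s : is_perm n s -> lehmer (perm_inv s) = code s.
Proof.
move=> ps; have un := is_perm_uniq ps.
apply: (@eq_from_nth _ 0); first by rewrite !size_map !size_iota.
rewrite /lehmer !size_map !size_iota => i hi.
rewrite (nth_map 0) ?size_iota // nth_iota // add0n nth_code hi.
rewrite /perm_inv (nth_map 0) ?size_iota // nth_iota // -map_drop drop_iota count_map.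
rewrite (is_perm_size ps) in hi *; set v := i.+1.
have vs : v \in s by rewrite (is_perm_mem _ ps).
transitivity (count (fun u => (v < u) && (index u s < index v s)) (iota 1 n)).
  have -> : iota 1 n = iota 1 v ++ iota v.+1 (n - v).
    by rewrite -[v.+1]add1n -iotaD subnKC.
  rewrite count_cat [X in _ = X + _](_ : _ = 0) ?add0n; last first.
    apply/eqP; rewrite -leqn0 leqNgt -has_count; apply/hasPn => u.
    by rewrite mem_iota /= => hu; have -> : v < u = false by lia.
  rewrite !add1n -/v.
  apply: eq_in_count => u; rewrite mem_iota /= /pos => hu.
  by rewrite ltnS; have -> : v < u = true by lia.
(* Now [s] is cut at [v]: the position test always holds in the prefix, and it fails in the rest
   because entries are distinct. *)
rewrite -(permP ps) /larger_before.
have /(congr1 (count (fun u => (v < u) && (index u s < index v s)))) <- :=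
  cat_take_drop (index v s) s; rewrite count_cat.
rewrite [X in _ + X](_ : _ = 0) ?addn0.
  apply: eq_in_count => u hu /=; have us := mem_take hu.
  by move: hu; rewrite in_take // => ->; rewrite andbT.
apply/eqP; rewrite -leqn0 leqNgt -has_count; apply/hasPn => u hu.
move: un; rewrite -{1}(cat_take_drop (index v s) s) cat_uniq => /and3P[_ /hasPn/(_ u hu) h _].
by move: h; rewrite /= in_take ?(mem_drop hu) // => /negbTE ->; rewrite andbF.
Qed.

Lemma PmapE n s : is_perm n s -> Pmap s = code_parts n (code s).
Proof.
move=> ps; rewrite /Pmap (lehmer_inv ps) (is_perm_size ps) /code_parts /descents.
rewrite size_code (is_perm_size ps); set A := filter _ _.
apply: (@eq_from_nth _ [::]); first by rewrite size_map size_iota size_pairmap.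
rewrite size_map size_iota => l hl.
rewrite (nth_map 0) ?size_iota // nth_iota // add0n (nth_pairmap 0) //.
Qed.

Lemma recoilsE n s : is_perm n s -> recoils s = descents (code s).
Proof.
move=> ps; rewrite /recoils /descents size_code (is_perm_size ps).
case: n ps => [|n] ps //.
(* [descents] also tests the last position, which [recoils] does not; it is split off, and the last
   code entry is [0] by the bound. *)
rewrite -[n.+1]addn1 iotaD filter_cat addn1 [filter _ (iota (1 + n) 1)]/=.
rewrite !nth_code (is_perm_size ps) add1n ltnn ltnSn.
have := larger_before_bound n.+1 ps; rewrite subnn leqn0 => /eqP ->; rewrite cats0.
apply: eq_in_filter => i; rewrite mem_iota => hi.
rewrite !nth_code (is_perm_size ps) prednK; last by lia.
rewrite !ifT; try lia.
by rewrite larger_before_succ.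
Qed.

(** Stripped zeros are read back as the default value, so partitions can be compared coordinatewise
    whatever their lengths. *)
Lemma nth_strip0 l j : nth 0 (strip0 l) j = nth 0 l j.
Proof.
rewrite /strip0; set k := find _ _.
have kz : k <= size l by rewrite -(size_rev l) find_size.
case: (ltnP j (size l)) => hj; last by rewrite !nth_default // size_rev size_drop size_rev; lia.
case: (ltnP j (size l - k)) => h.
  rewrite nth_rev ?size_drop ?size_rev // nth_drop nth_rev; last by lia.
  by congr nth; lia.
rewrite nth_default; last by rewrite size_rev size_drop size_rev.
have hb : size l - j.+1 < find (fun x => x != 0) (rev l) by rewrite -/k; lia.
have := before_find 0 hb; rewrite nth_rev; last by lia.
rewrite (_ : size l - (size l - j.+1).+1 = j); last by lia.
by case: (nth 0 l j).
Qed.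

Lemma strip0_cons x l : x != 0 -> strip0 (x :: l) = x :: strip0 l.
Proof.
move=> nx; rewrite /strip0 rev_cons -cats1 find_cat /= nx.
case: ifP => h; first by rewrite drop_cat -has_find h rev_cat.
rewrite addn0 drop_size_cat //; move/negbT: h; rewrite has_find -leqNgt => h.
by rewrite drop_oversize.
Qed.

Lemma nth_part n c m a j : j < a -> nth 0 (part n c m a) j = n - a - masked m c j.
Proof. by move=> h; rewrite nth_strip0 nth_mkseq. Qed.

Lemma descents_sorted c : path ltn 0 (descents c).
Proof.
rewrite path_sortedE; last exact: ltn_trans.
rewrite (sorted_filter ltn_trans) ?iota_ltn_sorted // andbT.
by apply/allP => i; rewrite mem_filter mem_iota => /and3P[].
Qed.

Lemma mem_descents c i :
  (i \in descents c) = (0 < i) && (nth 0 c i < nth 0 c i.-1).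
Proof.
rewrite mem_filter mem_iota add1n ltnS andbC -andbA; congr (_ && _).
case h: (nth 0 c i < _); rewrite ?andbF // andbT.
case: leqP => // hi; move: h; rewrite [X in _ < X]nth_default ?ltn0 //; lia.
Qed.

(** * Injectivity of the partition map *)

Lemma nondecreasing_off_descents c j i : j <= i ->
  (forall x, j < x <= i -> x \notin descents c) -> nth 0 c j <= nth 0 c i.
Proof.
elim: i => [|i IH]; first by rewrite leqn0 => /eqP ->.
rewrite leq_eqVlt => /predU1P[-> //|hj] h.
apply: leq_trans (IH hj _) _; first by move=> x hx; apply: h; lia.
by have := h i.+1; rewrite mem_descents /= -leqNgt; apply; lia.
Qed.

Lemma descents_lt n c a : (forall j, nth 0 c j <= n - j.+1) ->
  a \in descents c -> 0 < a < n.
Proof.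
move=> bc; rewrite mem_descents => /andP[a0 h]; rewrite a0 /=.
by have := bc a.-1; lia.
Qed.

(** As the code starts with [0], the first part of each partition is $n - a_l$, which recovers the
    descents. Coordinate [j] of the partition whose block contains [j] then gives the entry at
    [j]. *)
Lemma code_parts_inj n c c' :
    size c = n -> size c' = n ->
    (forall j, nth 0 c j <= n - j.+1) -> (forall j, nth 0 c' j <= n - j.+1) ->
    nth 0 c 0 = 0 -> nth 0 c' 0 = 0 ->
  code_parts n c = code_parts n c' -> c = c'.
Proof.
move=> sc sc' bc bc' c0 c'0 eP.
have nthP e m l : l < size (descents e) ->
    nth [::] (code_parts m e) l = part m e (nth 0 (0 :: descents e) l) (nth 0 (descents e) l).
  by move=> h; rewrite (nth_pairmap 0).
have szA : size (descents c) = size (descents c').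
  by have := congr1 size eP; rewrite !size_pairmap.
have first_part e l : l < size (descents e) -> (forall j, nth 0 e j <= n - j.+1) ->
    nth 0 e 0 = 0 -> nth 0 (nth [::] (code_parts n e) l) 0 = n - nth 0 (descents e) l.
  move=> hl be e0; have /andP[h0 hn] := descents_lt be (mem_nth 0 hl).
  by rewrite nthP // nth_part // /masked e0 if_same subn0.
have eqA : descents c = descents c'.
  apply: (@eq_from_nth _ 0) => // l hl; have hl' := hl; rewrite szA in hl'.
  have := first_part _ _ hl bc c0; rewrite eP first_part //.
  have h : nth 0 (descents c) l < n by case/andP: (descents_lt bc (mem_nth 0 hl)).
  have h' : nth 0 (descents c') l < n by case/andP: (descents_lt bc' (mem_nth 0 hl')).
  by lia.
apply: (@eq_from_nth _ 0); rewrite ?sc // => j hj.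
set l := find (ltn j) (descents c).
case: (leqP (size (descents c)) l) => hl.
  (* After the last descent the code increases weakly up to its last entry, which the bound forces
     to be [0]. *)
  have z e : (forall i, nth 0 e i <= n - i.+1) -> descents e = descents c ->
      nth 0 e j = 0.
    move=> be eA; have e_last : nth 0 e n.-1 = 0 by have := be n.-1; lia.
    suff : nth 0 e j <= nth 0 e n.-1 by rewrite e_last leqn0 => /eqP.
    apply: nondecreasing_off_descents => [|x /andP[hx _]]; first by lia.
    apply/negP; rewrite eA => xA.
    suff : has (ltn j) (descents c) by rewrite has_find ltnNge hl.
    by apply/hasP; exists x.
  by rewrite !z.
have ja : j < nth 0 (descents c) l by apply: nth_find; rewrite has_find.
have mj : nth 0 (0 :: descents c) l <= j.
  case El: l => [|l'] //=; rewrite leqNgt.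
  have ll : l' < find (ltn j) (descents c) by rewrite -/l El.
  by have /= -> := before_find 0 ll.
(* Inside a block the code increases weakly up to index $a_l - 1$, where the bound reads $n - a_l$.
   Hence the truncated subtraction loses no information. *)
have b e : (forall i, nth 0 e i <= n - i.+1) -> descents e = descents c ->
    nth 0 e j <= n - nth 0 (descents c) l.
  move=> be eA; apply: leq_trans (@nondecreasing_off_descents e j (nth 0 (descents c) l).-1 _ _) _.
  - by lia.
  - move=> x hx; apply/negP; rewrite eA => xA; have xi := xA.
    rewrite -index_mem in xi; have ll : l <= index x (descents c).
      rewrite leqNgt; apply/negP => /(before_find 0); rewrite nth_index //=; lia.
    have srt : sorted ltn (descents c) := path_sorted (descents_sorted c).
    have := sorted_leq_nth leq_trans leqnn 0 (sub_sorted ltnW srt).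
    by move=> /(_ l (index x (descents c)) hl xi ll); rewrite nth_index //; lia.
  - by apply: leq_trans (be _) _; lia.
have := congr1 (fun P => nth 0 (nth [::] P l) j) eP.
rewrite /= !nthP -?eqA // !nth_part // /masked ltnNge mj /=.
have := b _ bc erefl; have := b _ bc' (esym eqA); lia.
Qed.

Lemma larger_before_rem k v s : k < v ->
  larger_before v (rem k s) = larger_before v s.
Proof.
move=> kv; elim: s => [|x s IH] //=; rewrite larger_before_cons.
case: eqP => [->|_]; last by rewrite larger_before_cons IH.
by rewrite (ltn_eqF kv) ltnNge ltnW.
Qed.

(** All entries left of the smallest value [k] are larger, so the code entry of [k] is its position;
    inserting [k] there into the rest restores [s]. *)
Lemma perm_iota_split k n (s : seq nat) : perm_eq s (iota k n.+1) ->
  [/\ perm_eq (rem k s) (iota k.+1 n), index k s = larger_before k s &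
      s = take (index k s) (rem k s) ++ k :: drop (index k s) (rem k s)].
Proof.
move=> ps; have ks : k \in s by rewrite (perm_mem ps) mem_iota; lia.
have us : uniq s by rewrite (perm_uniq ps) iota_uniq.
have sz : size (take (index k s) s) = index k s by rewrite size_takel ?index_size.
split.
- by rewrite -(perm_cons k) (perm_trans _ ps) // perm_sym perm_to_rem.
- rewrite /larger_before -[LHS]sz -count_predT; apply: eq_in_count => x hx /=.
  have := mem_take hx; rewrite (perm_mem ps) mem_iota => /andP[kx _].
  rewrite ltn_neqAle kx andbT; apply/esym/eqP => ekx.
  by move: hx; rewrite -ekx in_take // ltnn.
- rewrite remE [take _ (_ ++ _)]take_size_cat // [drop _ (_ ++ _)]drop_size_cat //.
  by rewrite -[in LHS](cat_take_drop (index k s) s) (drop_nth k) ?index_mem // nth_index.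
Qed.

(** Deleting the smallest value leaves the code entries of the others unchanged, so the remaining
    words agree by induction, and the smallest value is put back at the position its entry gives. *)
Lemma code_inj k n (s s' : seq nat) : perm_eq s (iota k n) -> perm_eq s' (iota k n) ->
  (forall v, k <= v < k + n -> larger_before v s = larger_before v s') -> s = s'.
Proof.
elim: n k s s' => [|n IH] k s s' ps ps' h.
  by move: ps ps' => /perm_nilP -> /perm_nilP ->.
have [p1 i1 e1] := perm_iota_split ps; have [p2 i2 e2] := perm_iota_split ps'.
have er : rem k s = rem k s'.
  apply: IH p1 p2 _ => v hv; rewrite !larger_before_rem; try lia.
  by apply: h; lia.
by rewrite e1 e2 er i1 i2 h //; lia.
Qed.

Lemma code_bound n s j : is_perm n s -> nth 0 (code s) j <= n - j.+1.
Proof. by move=> ps; rewrite nth_code; case: ifP => // _; exact: larger_before_bound. Qed.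

Lemma Pmap_inj n s s' : is_perm n s -> is_perm n s' ->
  head 0 s = 1 -> head 0 s' = 1 -> Pmap s = Pmap s' -> s = s'.
Proof.
move=> ps ps' h1 h1'; rewrite !(PmapE ps, PmapE ps') => eP.
have z u : head 0 u = 1 -> nth 0 (code u) 0 = 0.
  by rewrite nth_code; case: u => //= x u ->.
have ec : code s = code s'.
  apply: code_parts_inj eP; rewrite ?size_code ?(is_perm_size ps) ?(is_perm_size ps') //;
    by [move=> j; exact: code_bound | exact: z].
apply: (@code_inj 1 n) => // v hv; have := congr1 (fun c => nth 0 c v.-1) ec.
rewrite !nth_code (is_perm_size ps) (is_perm_size ps') prednK ?ifT //; lia.
Qed.

(** The search in [P_inv] succeeds because [s] is a candidate, and injectivity identifies whatever
    it finds with [s]. *)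
Lemma P_inv_Pmap n k s : St n k s -> P_inv n k (Pmap s) = s.
Proof.
move=> Ss; have sl : s \in St_list n k.
  by rewrite mem_filter Ss mem_permutations; case/and4P: Ss.
have hs : has (fun u => Pmap u == Pmap s) (St_list n k) by apply/hasP; exists s.
have /eqP eP := nth_find [::] hs; rewrite /P_inv.
have : nth [::] (St_list n k) (find (fun u => Pmap u == Pmap s) (St_list n k)) \in St_list n k.
  by rewrite mem_nth // -has_find.
rewrite mem_filter => /andP[/and4P[p _ /eqP h _] _].
by case/and4P: Ss => ps _ /eqP h' _; apply: Pmap_inj p ps h h' eP.
Qed.

Lemma fK s : f_inv (f s) = s.
Proof. by rewrite /f_inv /= -map_comp map_id. Qed.

(** * Evil-avoidance *)

(* The disjuncts are the patterns 2413, 4132, 4213 and 3214, in this order. *)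
Definition evil (a b c d : nat) : bool :=
  [|| [&& c < a, a < d & d < b], [&& b < d, d < c & c < a],
      [&& c < b, b < d & d < a] | [&& c < b, b < a & a < d]].

Lemma mem_subseqs_k k (s t : seq nat) :
  (t \in subseqs_k k s) = (size t == k) && subseq t s.
Proof.
elim: s k t => [|x s IH] [|k] [|y t] //=; rewrite ?IH ?sub0seq ?andbF //.
  by rewrite mem_cat IH orbF; apply/negP => /mapP[].
rewrite mem_cat IH eqSS /=; have [->|nyx] := eqVneq y x.
  rewrite mem_map => [|u v [->] //]; rewrite IH.
  case: (size t == k) => //=; case h: (subseq t s) => //=; apply/negP => h'.
  by rewrite (subseq_trans (subseq_cons t x) h') in h.
suff /negbTE -> : y :: t \notin [seq x :: i | i <- subseqs_k k s] by [].
by apply/mapP => -[u _ [e _]]; rewrite e eqxx in nyx.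
Qed.

Lemma avoids4P (s p : seq nat) : size p = 4 ->
  reflect (forall a b c d, subseq [:: a; b; c; d] s -> ~~ order_iso [:: a; b; c; d] p)
          (avoids s p).
Proof.
move=> sp; apply: (iffP hasPn) => h.
  by move=> a b c d sub; apply: h; rewrite mem_subseqs_k sp.
move=> t; rewrite mem_subseqs_k sp; case: t => [|a [|b [|c [|d []]]]] //=.
exact: h.
Qed.

Lemma evil_avoidingP s :
  reflect (forall a b c d, subseq [:: a; b; c; d] s -> ~~ evil a b c d)
          (evil_avoiding s).
Proof.
apply: (iffP and4P) => [[/avoids4P h1 /avoids4P h2 /avoids4P h3 /avoids4P h4]|h].
  move=> a b c d sub.
  move: (h1 erefl a b c d sub) (h2 erefl a b c d sub) (h3 erefl a b c d sub) (h4 erefl a b c d sub).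
  by rewrite /order_iso /evil /=; lia.
by split; apply/avoids4P => // a b c d /h; rewrite /order_iso /evil /=; lia.
Qed.

Lemma evil_avoiding_sub s1 s2 : subseq s1 s2 -> evil_avoiding s2 -> evil_avoiding s1.
Proof.
move=> sub /evil_avoidingP h; apply/evil_avoidingP => a b c d h'.
exact/h/(subseq_trans h').
Qed.

Lemma subseq_mapP (g : nat -> nat) t s :
  subseq t (map g s) -> exists2 u, subseq u s & t = map g u.
Proof.
case/subseqP => m sm ->; exists (mask m s); last by rewrite map_mask.
exact: mask_subseq.
Qed.

Lemma subseq_catP (t s1 s2 : seq nat) : subseq t (s1 ++ s2) ->
  exists t1 t2, [/\ t = t1 ++ t2, subseq t1 s1 & subseq t2 s2].
Proof.
elim: s1 t => [|x s IH] t; first by exists [::], t.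
case: t => [|y t] /=; first by exists [::], [::]; rewrite !sub0seq.
case: eqP => [->|ne] /IH[t1 [t2 [e h1 h2]]].
  by exists (x :: t1), t2; rewrite /= eqxx e.
by exists t1, t2; split=> //; exact: subseq_trans h1 (subseq_cons _ _).
Qed.

Lemma evil_avoiding_map g s : {mono g : x y / x < y} ->
  evil_avoiding s -> evil_avoiding (map g s).
Proof.
move=> mg /evil_avoidingP h; apply/evil_avoidingP => a b c d /subseq_mapP[].
case=> [|a' [|b' [|c' [|d' []]]]] // /h e [-> -> -> ->].
by move: e; rewrite /evil !mg.
Qed.

Lemma evil_avoiding_cons x s :
  (forall b c d, subseq [:: b; c; d] s -> ~~ evil x b c d) ->
  evil_avoiding s -> evil_avoiding (x :: s).
Proof.
move=> hx /evil_avoidingP h; apply/evil_avoidingP => a b c d /=.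
by case: eqP => [->|_]; [exact: hx | exact: h].
Qed.

(** None of the four patterns begins with its smallest entry. *)
Lemma evil_avoiding_cons_min x s : all (leq x) s -> evil_avoiding s -> evil_avoiding (x :: s).
Proof.
move=> /allP hx; apply: evil_avoiding_cons => b c d /mem_subseq h.
have : forall y, y \in [:: b; c; d] -> x <= y by move=> y /h /hx.
move=> hy; have := hy b; have := hy c; have := hy d; rewrite !inE !eqxx !orbT /evil; lia.
Qed.

Lemma evil_avoiding_iota_cat k n s : all (leq (k + n)) s ->
  evil_avoiding s -> evil_avoiding (iota k n ++ s).
Proof.
move=> hs ev; elim: n k hs => [|n IH] k hs //=.
apply: evil_avoiding_cons_min; last by apply: IH; rewrite addSnnS.
rewrite all_cat; apply/andP; split; apply/allP => x; first by rewrite mem_iota; lia.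
by move/(allP hs); lia.
Qed.

(** In none of the four patterns does a nonempty final segment increase and lie below all earlier
    entries. The cases below follow the number of pattern entries taken from [s]. *)
Lemma evil_avoiding_cat_iota k n s : all (leq (k + n)) s ->
  evil_avoiding s -> evil_avoiding (s ++ iota k n).
Proof.
move=> /allP hs /evil_avoidingP ev; apply/evil_avoidingP => a b c d /subseq_catP[t1 [t2 [e h1 h2]]].
have s2 : sorted ltn t2 := subseq_sorted ltn_trans h2 (iota_ltn_sorted k n).
have l1 x : x \in t1 -> k + n <= x by move/(mem_subseq h1)/hs.
have l2 x : x \in t2 -> x < k + n by move/(mem_subseq h2); rewrite mem_iota => /andP[].
have l12 x y : x \in t1 -> y \in t2 -> y < x by move=> /l1 ? /l2 ?; lia.
move: t1 t2 e h1 s2 l12 {h2 l1 l2}.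
case=> [|a1 [|b1 [|c1 [|d1 t1]]]] t2 /=.
- by move=> <- _ /=; rewrite /evil; lia.
- by case=> <- <- _ /= ? /(_ a d); rewrite !inE !eqxx !orbT /evil => /(_ isT isT); lia.
- case=> <- <- <- _ /= ? l12; have := l12 b d; have := l12 a d; have := l12 a c; have := l12 b c.
  rewrite !inE !eqxx !orbT /evil; lia.
- case=> <- <- <- <- _ /= ? l12; have := l12 b d; have := l12 a d; have := l12 c d.
  rewrite !inE !eqxx !orbT /evil; lia.
- by case=> <- <- <- <- ; case: t1 t2 => [|? ?] [|? ?] // _ h1 _ _; exact: ev h1.
Qed.

(** * Effect of code operations on partition sequences *)

Lemma strip0_nseq0 d : strip0 (nseq d 0) = [::].
Proof.
rewrite /strip0; have -> : rev (nseq d 0) = nseq d 0.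
  apply: (@eq_from_nth _ 0); rewrite size_rev // size_nseq => i hi.
  by rewrite nth_rev ?size_nseq // !nth_nseq; case: ifP; case: ifP.
rewrite drop_oversize //; apply: contraT; rewrite -ltnNge -has_find.
by rewrite has_nseq andbF.
Qed.

Lemma strip0_nseq_cat d x l : x != 0 -> strip0 (nseq d x ++ l) = nseq d x ++ strip0 l.
Proof. by move=> nx; elim: d => //= d IH; rewrite strip0_cons // IH. Qed.

Lemma part_first_block n u v : part n (u ++ v) 0 (size u) = strip0 (map (subn (n - size u)) u).
Proof.
congr strip0; apply: (@eq_from_nth _ 0); rewrite size_mkseq ?size_map // => i hi.
by rewrite nth_mkseq // (nth_map 0) // /masked /= nth_cat hi.
Qed.

(** The difference between total size and descent is the same on both sides, and nothing is
    subtracted in the [d] new leading places, which therefore repeat the first part [n - a]. That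
    part is positive, so stripping zeros does not reach it. *)
Lemma part_shift n d c c' m m' a : 0 < a < n -> masked m c 0 = 0 ->
    (forall j, j < d -> masked m' c' j = 0) ->
    (forall j, masked m' c' (d + j) = masked m c j) ->
  part (n + d) c' m' (d + a) = dup_first_n d (part n c m a).
Proof.
move=> /andP[a0 an] m0 hd hs.
have na : n - a != 0 by lia.
have -> : dup_first_n d (part n c m a) = nseq d (n - a) ++ part n c m a.
  by rewrite /part; case: a a0 {an} na => // a _ na; rewrite /mkseq /= m0 subn0 strip0_cons.
rewrite /part -strip0_nseq_cat //; congr strip0.
apply: (@eq_from_nth _ 0); rewrite size_mkseq ?size_cat ?size_nseq ?size_mkseq // => j hj.
rewrite nth_mkseq // nth_cat size_nseq nth_nseq; case: ltnP => hjd.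
  by rewrite hd //; lia.
rewrite nth_mkseq; last by lia.
by rewrite -hs subnKC //; lia.
Qed.

(** The initial previous descents [x] and [x'] need not differ by [d], hence the pointwise
    conditions on the masked codes; from the second step on they differ by exactly [d]. *)
Lemma pairmap_part_shift n d c c' A x x' :
    masked x c 0 = 0 -> (forall j, j < d -> masked x' c' j = 0) ->
    (forall j, masked x' c' (d + j) = masked x c j) ->
    path ltn x A -> (forall a, a \in A -> a < n /\ x' <= d + a) ->
  pairmap (part (n + d) c') x' (map (addn d) A)
  = map (dup_first_n d) (pairmap (part n c) x A).
Proof.
elim: A x x' => [|a A IH] x x' //= m0 hd hs /andP[xa pA] hA.
have [an x'a] := hA a (mem_head _ _).
rewrite (@part_shift n d c c' x x' a) //; last by rewrite an (leq_ltn_trans _ xa).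
congr (_ :: _); apply: IH => //.
- by rewrite /masked (leq_ltn_trans _ xa).
- by move=> j hj; rewrite /masked ltn_addr.
- move=> j; have := hs j; rewrite /masked ltn_add2l.
  have [//|aj] := ltnP j a.
  by rewrite !ltnNge (leq_trans x'a) ?leq_add2l //= (leq_trans (ltnW xa) aj).
- move=> b bA; have [bn _] := hA b (mem_behead (s := a :: A) bA); split=> //.
  by rewrite leq_add2l ltnW // (allP (order_path_min ltn_trans pA)).
Qed.

Lemma descents0 c : descents (0 :: c) = map (addn 1) (descents c).
Proof.
rewrite /descents /= -[iota 2 _]/(iota (1 + 1) _) iotaDl filter_map; congr map.
by apply: eq_in_filter => -[|i] //=; rewrite mem_iota.
Qed.

Lemma descents_cat u v : sorted leq u -> head 0 v < last 0 u ->
  descents (u ++ v) = size u :: map (addn (size u)) (descents v).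
Proof.
move=> su hl; have su0 : 0 < size u by case: u hl {su}.
rewrite /descents size_cat.
have -> : iota 1 (size u + size v) = iota 1 (size u).-1 ++ size u :: iota (size u).+1 (size v).
  have -> : size u + size v = (size u).-1 + (size v).+1 by lia.
  by rewrite iotaD add1n prednK.
rewrite filter_cat [filter _ (iota 1 _)](_ : _ = [::]) /=; last first.
  apply/eqP; rewrite -size_eq0 size_filter -leqn0 leqNgt -has_count; apply/hasPn => i.
  rewrite mem_iota => hi; rewrite !nth_cat !ifT; try lia; rewrite -leqNgt.
  have /(_ i.-1) := sortedP 0 su; rewrite prednK; last by lia.
  by apply; lia.
rewrite !nth_cat ltnn subnn prednK // leqnn nth_last nth0 hl; congr cons.
rewrite -addn1 iotaDl filter_map; congr map.
apply: eq_in_filter => i; rewrite mem_iota => hi /=.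
by rewrite !nth_cat !ifF; try lia; congr (nth 0 v _ < nth 0 v _); lia.
Qed.

Lemma descents_consE c t A : descents c = t :: A ->
  [/\ 0 < t <= size c, sorted leq (take t c) & head 0 (drop t c) < last 0 (take t c)].
Proof.
move=> eA; have td : t \in descents c by rewrite eA mem_head.
have := td; rewrite mem_descents => /andP[t0 ht].
have tc : t <= size c by move: td; rewrite mem_filter mem_iota; lia.
rewrite t0 tc; split=> //.
  apply/(sortedP 0) => i; rewrite size_takel // => hi.
  rewrite !nth_take ?(ltnW hi) //; apply: nondecreasing_off_descents => // x hx.
  have := descents_sorted c; rewrite eA /= => /andP[_ pA].
  rewrite inE; apply/norP; split; first by lia.
  by apply/negP => /(allP (order_path_min ltn_trans pA)); lia.
by rewrite -nth0 nth_drop addn0 -nth_last size_takel // nth_take // prednK.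
Qed.

Lemma code_parts_dup1 n c : (forall j, nth 0 c j <= n - j.+1) -> nth 0 c 0 = 0 ->
  code_parts n.+1 (0 :: c) = map dup_first (code_parts n c).
Proof.
move=> bc c0; rewrite /code_parts descents0 -addn1 (@pairmap_part_shift n 1 c _ _ 0 0).
- by apply: eq_map => -[|? ?].
- by rewrite /masked.
- by case.
- by move=> j; rewrite /masked.
- exact: descents_sorted.
- by move=> a /(descents_lt bc) /andP[].
Qed.

(** The block [0 :: nseq d i.-1] ends at the new first descent [d.+1]; subtracted from [d.+1] copies
    of [i.-1] it leaves [i.-1] followed by zeros. In every later part this block is masked and acts
    as [d.+1] leading zeros, one of which is the [0] already in front of [c]. *)
Lemma code_parts_Phi i d c : 1 < i -> 0 < d -> (forall j, nth 0 c j <= i.-1 - j.+1) ->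
  code_parts (i + d) (0 :: nseq d i.-1 ++ c) =
  [:: i.-1] :: map (dup_first_n d) (code_parts i (0 :: c)).
Proof.
move=> i1 d0 bc.
have bc0 j : nth 0 (0 :: c) j <= i - j.+1.
  by case: j => [|j] //=; have := bc j; lia.
rewrite /code_parts -cat_cons; set u := 0 :: _.
have su : size u = d.+1 by rewrite /= size_nseq.
(* Read from position [d] on, the new code is [0 :: c] except for its first entry, which is masked
   in all later parts. *)
have nu j : nth 0 (u ++ c) (d + j) = if j is 0 then i.-1 else nth 0 (0 :: c) j.
  rewrite nth_cat su; case: j => [|j]; last by rewrite ifF; [congr nth|]; lia.
  rewrite addn0 ltnSn /u; case: (d) d0 => // d' _.
  by rewrite -[LHS]/(nth 0 (nseq d'.+1 i.-1) d') nth_nseq ltnSn.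
rewrite descents_cat; first last.
- rewrite -nth0 -nth_last su /= /u; case: (d) d0 => // d' _.
  rewrite -[X in _ < X]/(nth 0 (nseq d'.+1 i.-1) d') nth_nseq ltnSn; have := bc 0; lia.
- apply/(sortedP 0) => -[|j] //; rewrite su /= => hj.
  by rewrite !nth_nseq !ifT; lia.
rewrite -[pairmap _ _ _]/(part _ (u ++ c) 0 (size u) :: pairmap _ (size u) _).
rewrite part_first_block su; congr (_ :: _).
  rewrite /u /= (_ : i + d - d.+1 = i.-1); last by lia.
  by rewrite map_nseq subnn subn0 strip0_cons ?strip0_nseq0 //; lia.
rewrite -addn1 (eq_map (g := addn d \o addn 1)); last by move=> x /=; rewrite addnA.
rewrite map_comp -descents0 (@pairmap_part_shift i d (0 :: c) _ _ 0 (d + 1)) //.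
- by move=> j hj; rewrite /masked addn1 ltnS (ltnW hj).
- move=> j; rewrite /masked addn1 ltnS nu; case: j => [|j]; first by rewrite addn0 leqnn.
  by rewrite ifF //; lia.
- exact: descents_sorted.
- by move=> a /(descents_lt bc0) /andP[]; lia.
Qed.

Lemma code_parts_first_block n c1 c2 : sorted leq c1 -> head 0 c2 < last 0 c1 ->
  (size c1).+1 < n ->
  code_parts n (0 :: c1 ++ c2) =
    (n - (size c1).+1 :: strip0 (map (subn (n - (size c1).+1)) c1)) ::
    pairmap (part n (0 :: c1 ++ c2)) (size c1).+1
      (map (addn (size c1).+1) (descents c2)).
Proof.
move=> s1 hl sn; rewrite /code_parts -cat_cons descents_cat /=.
- by rewrite -cat_cons (part_first_block n (0 :: c1)) /= subn0 strip0_cons //; lia.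
- by case: c1 s1 {hl sn}.
- by case: c1 hl {s1 sn}.
Qed.

(** This serves both cases of [psi_q]. Whatever the new first block is, later parts see it only as
    masked positions, and the inserted [0] moves every later descent by one. *)
Lemma code_parts_dup_tail n c1 c1' c2 : size c1' = size c1 ->
    sorted leq c1 -> sorted leq c1' -> head 0 c2 < last 0 c1 -> 0 < last 0 c1' ->
    (size c1).+1 < n -> (forall j, nth 0 (0 :: c1 ++ c2) j <= n - j.+1) ->
  code_parts n.+1 (0 :: c1' ++ 0 :: c2) =
    (n - size c1 :: strip0 (map (subn (n - size c1)) c1')) ::
    map dup_first (behead (code_parts n (0 :: c1 ++ c2))).
Proof.
move=> s11 s1 s1' hl hl' sn bc; rewrite !code_parts_first_block //; try by rewrite s11; lia.
rewrite s11 subSS; congr (_ :: _); rewrite /= descents0.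
rewrite -map_comp (eq_map (g := addn 1 \o addn (size c1).+1)); last first.
  by move=> x /=; rewrite !add1n addnS.
rewrite map_comp -addn1 (@pairmap_part_shift n 1 (0 :: c1 ++ c2) _ _ (size c1).+1).
- by apply: eq_map => -[|? ?].
- by rewrite /masked.
- by case.
(* For [j = size c1], position [1 + j] holds the inserted [0]: it is not masked, but it agrees with
   the masked position on the other side. *)
- move=> j; rewrite /masked add1n ltnS; case: (ltngtP j (size c1).+1) => hj /=.
  + case: ltnP => // hj'; rewrite (_ : j = size c1); last by lia.
    by rewrite nth_cat s11 ltnn subnn.
  + rewrite ifF; last by lia.
    case: j hj => // j hj; rewrite /= !nth_cat s11 !ifF; try lia.
    by rewrite (_ : j.+1 - size c1 = (j - size c1).+1) //; lia.
  + by rewrite ifF ?hj /= ?nth_cat ?s11 ?ltnn ?ifF ?subSn //; lia.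
- have := descents_sorted (0 :: c1 ++ c2).
  rewrite -cat_cons descents_cat /= //.
  by case: c1 s1 {hl sn bc s11}.
- move=> a ha; have /(descents_lt bc) /andP[] : a \in descents (0 :: c1 ++ c2).
    rewrite -cat_cons descents_cat /= ?inE ?ha ?orbT //.
    by case: c1 s1 {hl sn bc s11 ha}.
  by case/mapP: ha => x _ ->; lia.
Qed.

(** * The operators psi_p and psi_(i,k,n) *)

Lemma code_f s : code (f s) = 0 :: code s.
Proof.
rewrite /code /= size_map -[iota 2 _]/(iota (1 + 1) _) iotaDl -map_comp; congr cons.
apply/eq_in_map => v; rewrite mem_iota => /andP[v1 _] /=.
rewrite larger_before_cons add1n ifF; last by case: v v1.
exact: (@larger_before_map S).
Qed.

Lemma nrecoilsE n s : is_perm n s -> nrecoils s = size (descents (code s)).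
Proof. by move=> ps; rewrite /nrecoils (recoilsE ps). Qed.

Lemma f_St m k s : Evil m k s -> St m.+1 k (f s).
Proof.
case/and3P => ps ev /eqP rk.
have pf : is_perm m.+1 (f s).
  by rewrite /is_perm /= perm_cons -[2]/(1 + 1) iotaDl perm_map.
apply/and4P; split=> //.
  apply: evil_avoiding_cons_min; last exact: evil_avoiding_map ev.
  by apply/allP => _ /mapP[x _ ->].
by rewrite (nrecoilsE pf) code_f descents0 size_map -(nrecoilsE ps) rk.
Qed.

(** By this reduction each identity follows once the output is known to be evil-avoiding with the
    right number of recoils and to have the expected partition sequence; no inverse has to be
    computed. *)
Lemma f_inv_P_inv m k s X : Evil m k s -> code_parts m.+1 (0 :: code s) = X ->
  s = f_inv (P_inv m.+1 k X).
Proof.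
move=> ev <-; have Sf := f_St ev; have /and4P[pf _ _ _] := Sf.
by rewrite -code_f -(PmapE pf) (P_inv_Pmap Sf) fK.
Qed.

Lemma Pmap_f m k s : Evil m k s -> Pmap (f s) = code_parts m.+1 (0 :: code s).
Proof. by move/f_St => /and4P[pf _ _ _]; rewrite (PmapE pf) code_f. Qed.

Lemma code_bound0 m s j : is_perm m s -> nth 0 (0 :: code s) j <= m.+1 - j.+1.
Proof. by case: j => [|j] ps //=; rewrite subSS; exact: code_bound. Qed.

Lemma psi_pE m s : is_perm m s -> psi_p s = f s.
Proof.
move=> ps; rewrite /psi_p /rho /= take0 drop0 /=; congr cons.
by apply/eq_in_map => x; rewrite (is_perm_mem _ ps) => /andP[-> _].
Qed.

Lemma psi_p_parts m k s : Evil m k s ->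
  psi_p s = f_inv (P_inv (m + 2) k (Psi1 (Pmap (f s)))).
Proof.
move=> ev; have /and3P[ps _ _] := ev; rewrite (psi_pE ps) addn2.
apply: f_inv_P_inv; first by case/and4P: (f_St ev) => p e _ r; apply/and3P.
rewrite (Pmap_f ev) code_f code_parts_dup1 // => j; exact: code_bound0.
Qed.

Lemma larger_before_iota v k n : k <= v -> larger_before v (iota k n) = 0.
Proof.
elim: n k => [|n IH] k kv //=; rewrite larger_before_cons.
by case: eqP => // nkv; rewrite ltnNge kv IH //; lia.
Qed.

Lemma count_gt0P v s : all (leq^~ v) s -> count (ltn v) s = 0.
Proof.
move/allP => h; apply/eqP; rewrite -leqn0 leqNgt -has_count; apply/hasPn => x /h /=.
by rewrite -leqNgt.
Qed.

Lemma code_cat_iota d s : is_perm (size s) s ->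
  code (map (addn^~ d) s ++ iota 1 d) = nseq d (size s) ++ code s.
Proof.
move=> ps; rewrite /code size_cat size_map size_iota addnC iotaD map_cat; congr (_ ++ _).
  apply: (@eq_from_nth _ 0); rewrite size_map size_iota ?size_nseq // => j hj.
  rewrite (nth_map 0) ?size_iota // nth_iota // nth_nseq hj larger_before_cat ifF; last first.
    by apply/mapP => -[x]; rewrite (is_perm_mem _ ps); lia.
  rewrite larger_before_iota // addn0 -[RHS](size_map (addn^~ d)); apply/eqP.
  by rewrite -all_count; apply/allP => _ /mapP[x xs ->] /=; move: xs; rewrite (is_perm_mem _ ps); lia.
rewrite addnC iotaDl -map_comp; apply/eq_in_map => v; rewrite mem_iota => hv /=.
rewrite larger_before_cat addnC -[v + d]/((addn^~ d) v) ifT; last first.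
  by apply: map_f; rewrite (is_perm_mem _ ps); lia.
by rewrite (@larger_before_map (addn^~ d)) // => x y; rewrite ltn_add2r.
Qed.

Lemma psi_ikn_Evil i k n s : 1 <= k -> k + 1 <= i -> i <= n - 1 -> Evil (i - 1) (k - 1) s ->
  Evil n.-1 k (psi_ikn i k n s).
Proof.
move=> k1 ki ni /and3P[ps ev /eqP rk]; rewrite /psi_ikn; set d := n - i.
have sz := is_perm_size ps.
have pp : is_perm n.-1 (map (addn^~ d) s ++ iota 1 d).
  rewrite /is_perm (_ : n.-1 = d + (i - 1)); last by lia.
  rewrite iotaD perm_catC perm_cat2l (eq_map (g := addn d)) ?[1 + d]addnC ?iotaDl ?perm_map //.
  by move=> x; rewrite addnC.
apply/and3P; split=> //.
  apply: evil_avoiding_cat_iota; last by apply: evil_avoiding_map ev => x y; rewrite ltn_add2r.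
  by apply/allP => _ /mapP[x xs ->]; move: xs; rewrite (is_perm_mem _ ps); lia.
rewrite (nrecoilsE pp) code_cat_iota ?sz // descents_cat.
- by rewrite /= size_map -(nrecoilsE ps) rk; lia.
- apply/(sortedP 0) => j; rewrite size_nseq => hj; rewrite !nth_nseq !ifT //; lia.
- have := code_bound 0 ps; rewrite -nth_last -nth0 size_nseq nth_nseq ifT; lia.
Qed.

Lemma psi_ikn_parts i k n s : 1 <= k -> k + 1 <= i -> i <= n - 1 -> Evil (i - 1) (k - 1) s ->
  psi_ikn i k n s = f_inv (P_inv n k (Phi i k n (Pmap (f s)))).
Proof.
move=> k1 ki ni ev; have /and3P[ps _ _] := ev.
have -> : n = n.-1.+1 by lia.
apply: f_inv_P_inv; first by rewrite [n.-1.+1]prednK; [exact: psi_ikn_Evil|lia].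
rewrite prednK; last by lia.
rewrite (Pmap_f ev) /Phi code_cat_iota ?(is_perm_size ps) // subn1 (_ : i.-1.+1 = i); last by lia.
rewrite -code_parts_Phi; try lia; first by rewrite subnKC //; lia.
by move=> j; rewrite -subn1; exact: code_bound.
Qed.

(** * The operator psi_q *)

Definition skip (t x : nat) : nat := if t < x then x.+1 else x.

Lemma skip_mono t : {mono skip t : x y / x < y}.
Proof. by move=> x y; rewrite /skip; case: (ltnP t x); case: (ltnP t y); lia. Qed.

Lemma map_skip_low t s : all (leq^~ t) s -> map (skip t) s = s.
Proof. by move/allP=> h; apply: map_id_in => x /h; rewrite /skip ltnNge => ->. Qed.

Lemma map_skip_high t r : map (skip t) (iota t.+1 r) = iota t.+2 r.
Proof.
rewrite -[t.+2]add1n iotaDl; apply/eq_in_map => x; rewrite mem_iota => /andP[h _].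
by rewrite /skip h.
Qed.

Lemma rho_skip t s : rho t.+1 1 s = t.+1 :: map (skip t) s.
Proof. by rewrite /rho /= take0 drop0. Qed.

Lemma rho_perm m t s : t <= m -> is_perm m s -> is_perm m.+1 (t.+1 :: map (skip t) s).
Proof.
move=> tm ps; apply: (@perm_trans _ (t.+1 :: map (skip t) (iota 1 m))).
  by rewrite perm_cons perm_map.
rewrite -{2}(subnKC tm) -addnS !iotaD -{1}(subnKC tm) iotaD map_cat.
rewrite map_skip_low; last by apply/allP => x; rewrite mem_iota; lia.
by rewrite add1n map_skip_high /= -[_ :: _ ++ _]cat1s perm_catCA.
Qed.

(** The new entry [t.+1] precedes everything, so it adds one to the count of each value up to [t]
    and nothing to the others; its own count is [0]. *)
Lemma code_rho m t s : t < m -> is_perm m s ->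
  code (t.+1 :: map (skip t) s) = map succn (take t (code s)) ++ 0 :: drop t (code s).
Proof.
move=> tm ps; have sz := is_perm_size ps.
have -> : code (t.+1 :: map (skip t) s) =
    map (larger_before^~ (t.+1 :: map (skip t) s)) (iota 1 (t + (m - t).+1)).
  by rewrite addnS subnKC ?(ltnW tm) // /code /= size_map sz.
rewrite iotaD map_cat /= add1n larger_before_cons eqxx.
have -> : code s = map (larger_before^~ s) (iota 1 t) ++ map (larger_before^~ s) (iota t.+1 (m - t)).
  by rewrite -map_cat -[t.+1]add1n -iotaD subnKC ?(ltnW tm) // /code sz.
rewrite take_size_cat ?drop_size_cat ?size_map ?size_iota //; congr (_ ++ _ :: _).
  rewrite -map_comp; apply/eq_in_map => v; rewrite mem_iota => hv /=.
  rewrite larger_before_cons ifF; last by lia.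
  rewrite (_ : v < t.+1) ?add1n; last by lia.
  by rewrite -{1}(_ : skip t v = v) ?(larger_before_map _ _ (skip_mono t)) // /skip ifF //; lia.
rewrite -map_skip_high -map_comp; apply/eq_in_map => v; rewrite mem_iota => hv /=.
rewrite larger_before_cons (larger_before_map _ _ (skip_mono t)).
by rewrite /skip; do 2?case: ifP; lia.
Qed.

Lemma index_subseq t (s : seq nat) : all (mem s) t ->
  sorted ltn (map (index^~ s) t) -> subseq t s.
Proof.
move=> /allP ts srt; set l := map _ _ in srt.
have -> : t = map (nth 0 s) l.
  by rewrite -map_comp map_id_in // => x /ts xs /=; rewrite nth_index.
rewrite -[X in subseq _ X](mkseq_nth 0); apply: map_subseq.
(* A strictly increasing list of positions is the sublist of all positions that it selects. *)
have -> : l = [seq i <- iota 0 (size s) | i \in l].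
  apply: (irr_sorted_eq ltn_trans ltnn srt).
    exact: sorted_filter ltn_trans _ _ (iota_ltn_sorted _ _).
  move=> i; rewrite mem_filter mem_iota /= add0n; case il : (i \in l) => //=.
  by case/mapP: il => x /ts xs ->; rewrite index_mem.
exact: filter_subseq.
Qed.

Lemma subseq_index t (s : seq nat) : uniq s -> subseq t s ->
  sorted ltn (map (index^~ s) t).
Proof.
move=> us /(map_subseq (index^~ s)) h; apply: (subseq_sorted ltn_trans h).
suff -> : map (index^~ s) s = iota 0 (size s) by exact: iota_ltn_sorted.
apply: (@eq_from_nth _ 0); rewrite size_map ?size_iota // => i hi.
by rewrite (nth_map 0) // index_uniq // nth_iota.
Qed.

(* The values [1, ..., t] occur in increasing order in [s], so the new first entry
   can only act as the 2 of a 2413, with [b c d] as the 413 and [c <= t < d].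
   Wherever [t.+1], which precedes [t], sits relative to [b] and [c], one of
   4132 (on [b c t.+1 t]), 4213 (on [b t.+1 c d]) or 2413 (on [t.+1 b c d])
   already occurs in [s]. *)
Lemma rho_evil_avoiding m t A s : is_perm m s -> evil_avoiding s ->
  recoils s = t :: A -> evil_avoiding (t.+1 :: map (skip t) s).
Proof.
move=> ps ev rs.
have [t0 tm ht] : [/\ 0 < t, t < m & index t.+1 s < index t s].
  have : t \in recoils s by rewrite rs mem_head.
  rewrite mem_filter mem_iota (is_perm_size ps) /pos => /and3P[h1 h2 h3].
  by split=> //; lia.
have step i : 0 < i < t -> index i s < index i.+1 s.
  move=> /andP[i0 it].
  have : i \notin recoils s.
    have : sorted ltn (recoils s) by apply: (sorted_filter ltn_trans); exact: iota_ltn_sorted.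
    rewrite rs /= => /(order_path_min ltn_trans) /allP h.
    by rewrite inE; apply/norP; split; [lia | apply/negP => /h; lia].
  rewrite mem_filter mem_iota (is_perm_size ps) /pos (_ : 0 < i < 1 + m.-1); last by lia.
  rewrite andbT -leqNgt leq_eqVlt => /predU1P[e|//].
  have : nth 0 s (index i s) = nth 0 s (index i.+1 s) by rewrite e.
  by rewrite !nth_index ?(is_perm_mem _ ps); lia.
have mono x y : 0 < x -> x < y <= t -> index x s < index y s.
  move=> x0; elim: y => // y IH /andP[]; rewrite ltnS leq_eqVlt => /predU1P[e|xy] yt.
        by rewrite -e; apply: step; lia.
  by apply: ltn_trans (IH _) (step _ _); lia.
have E a b c d : a \in s -> b \in s -> c \in s -> d \in s ->
    index a s < index b s -> index b s < index c s -> index c s < index d s -> ~~ evil a b c d.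
  move=> ha hb hc hd h1 h2 h3; apply: (evil_avoidingP _ ev); apply: index_subseq.
    by rewrite /= ha hb hc hd.
  by rewrite /= h1 h2 h3.
apply: evil_avoiding_cons; last exact: evil_avoiding_map (skip_mono t) ev.
move=> ? ? ? /subseq_mapP[[|b [|c [|d []]]] //] sub [-> -> ->].
have /= /and3P[ibc icd _] := subseq_index (is_perm_uniq ps) sub.
have hb : b \in s by apply: (mem_subseq sub); rewrite !inE eqxx.
have hc : c \in s by apply: (mem_subseq sub); rewrite !inE eqxx orbT.
have hd : d \in s by apply: (mem_subseq sub); rewrite !inE eqxx !orbT.
have hT : t.+1 \in s by rewrite (is_perm_mem _ ps).
have ht' : t \in s by rewrite (is_perm_mem _ ps); lia.
have c0 : 0 < c by move: hc; rewrite (is_perm_mem _ ps); lia.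
have d0 : 0 < d by move: hd; rewrite (is_perm_mem _ ps); lia.
have skip_lt x : (skip t x < t.+1) = (x <= t) by rewrite /skip; case: ifP; lia.
have skip_gt x : (t.+1 < skip t x) = (t < x) by rewrite /skip; case: ifP; lia.
rewrite /evil !skip_mono !skip_lt !skip_gt; apply/negP => /or4P[].
- case/and3P => ct td db.
  have neq x y : x \in s -> index x s = index y s -> x = y.
    move=> xs e; have : nth 0 s (index x s) = nth 0 s (index y s) by rewrite e.
    by rewrite !nth_index // -index_mem -e index_mem.
  case: (ltngtP (index c s) (index t.+1 s)) => hcT.
  + have nct : c != t by apply/eqP => e; move: hcT; rewrite e; lia.
    by have := E b c t.+1 t hb hc hT ht' ibc hcT ht; rewrite /evil; lia.
  + have ndT : d != t.+1 by apply/eqP => e; move: icd; rewrite e; lia.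
    case: (ltngtP (index b s) (index t.+1 s)) => hbT.
    * by have := E b t.+1 c d hb hT hc hd hbT hcT icd; rewrite /evil; lia.
    * by have := E t.+1 b c d hT hb hc hd hbT ibc icd; rewrite /evil; lia.
    * by have := neq _ _ hb hbT; lia.
  + by have := neq _ _ hc hcT; lia.
- by case/and3P => bd dc ct; have := mono d c d0; rewrite dc ct => /(_ isT); lia.
- case/and3P => cb bd dt; have := mono c b c0; rewrite cb (leq_trans (ltnW bd) dt) => /(_ isT); lia.
- by case/and3P => cb bt _; have := mono c b c0; rewrite cb bt => /(_ isT); lia.
Qed.

(** * The sandwiched case *)

Section Sandwich.

(** The second sandwich parameter is written [b.+1] since it is at least 1. [whole] is the
    sandwiched permutation, and [moved] is what [gamma] makes of [rho t.+1 1 whole]. *)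
Variables (a b r : nat) (mid : seq nat).
Hypothesis mid_perm : perm_eq mid (iota (a + b.+1).+1 r).

Let t := a + b.+1.
Let rest := [seq larger_before v mid | v <- iota t.+1 r].
Let whole := iota 1 a ++ mid ++ iota a.+1 b.+1.
Let moved := t.+1 :: iota 1 a.+1 ++ map (skip t) mid ++ iota a.+2 b.

Let mem_mid x : (x \in mid) = (t < x <= t + r).
Proof. by rewrite (perm_mem mid_perm) mem_iota addSn ltnS. Qed.

Let size_mid : size mid = r.
Proof. by rewrite (perm_size mid_perm) size_iota. Qed.

Let iota_last : iota 1 a.+1 = iota 1 a ++ [:: a.+1].
Proof. by have := iotaD 1 a 1; rewrite addn1. Qed.

Lemma code_sandwiched : code whole = (nseq a 0 ++ nseq b.+1 r) ++ rest.
Proof.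
rewrite /code !size_cat !size_iota size_mid (_ : a + (r + b.+1) = a + (b.+1 + r)); last by lia.
rewrite !iotaD !map_cat catA; congr ((_ ++ _) ++ _).
- apply: (@eq_from_nth _ 0); rewrite size_map size_iota ?size_nseq // => j hj.
  rewrite (nth_map 0) ?size_iota // nth_iota // nth_nseq hj larger_before_cat ifT.
    by rewrite larger_before_iota.
  by rewrite mem_iota; lia.
- apply: (@eq_from_nth _ 0); rewrite size_map size_iota ?size_nseq // => j hj.
  rewrite (nth_map 0) ?size_iota // nth_iota // nth_nseq hj larger_before_cat ifF; last first.
    by rewrite mem_iota; lia.
  rewrite larger_before_cat ifF; last by rewrite mem_mid /t; lia.
  rewrite larger_before_iota ?addn0; last by lia.
  rewrite count_gt0P; last by apply/allP => x; rewrite mem_iota; lia.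
  rewrite add0n -[RHS]size_mid; apply/eqP; rewrite -all_count; apply/allP => x.
  by rewrite mem_mid /t /=; lia.
- rewrite -addnA add1n; apply/eq_in_map => v; rewrite mem_iota => hv.
  rewrite larger_before_cat ifF; last by rewrite mem_iota /t; lia.
  rewrite larger_before_cat ifT; last by rewrite mem_mid /t; lia.
  by rewrite count_gt0P //; apply/allP => x; rewrite mem_iota /t; lia.
Qed.

(** Without [gamma] the block before the [0] would be [a] ones and then [b.+1] copies of [r.+1].
    Moving the value [a.+1] in front of [mid] removes [r] larger entries from its left and turns one
    [r.+1] into [1]. *)
Lemma code_moved : code moved = (nseq a.+1 1 ++ nseq b r.+1) ++ 0 :: rest.
Proof.
have sm : size moved = a.+1 + (b + r.+1).
  by rewrite /moved /= !size_cat size_map !size_iota size_mid; lia.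
rewrite /code sm iotaD map_cat -catA; congr (_ ++ _).
  apply: (@eq_from_nth _ 0); rewrite size_map size_iota ?size_nseq // => j hj.
  rewrite (nth_map 0) ?size_iota // nth_iota // nth_nseq hj larger_before_cons ifF; last first.
    by rewrite /t; lia.
  rewrite larger_before_cat ifT; last by rewrite mem_iota; lia.
  rewrite larger_before_iota ?addn0; last by lia.
  by rewrite (_ : 1 + j < t.+1) // /t; lia.
have low v : a.+1 < v -> larger_before v moved =
    if t.+1 == v then 0 else (v < t.+1) + larger_before v (map (skip t) mid ++ iota a.+2 b).
  move=> hv; rewrite larger_before_cons; case: ifP => // _; congr (_ + _).
  rewrite larger_before_cat ifF; last by rewrite mem_iota; lia.
  by rewrite count_gt0P //; apply/allP => x; rewrite mem_iota; lia.
rewrite iotaD map_cat; congr (_ ++ _).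
  apply: (@eq_from_nth _ 0); rewrite size_map size_iota ?size_nseq // => j hj.
  rewrite (nth_map 0) ?size_iota // nth_iota // nth_nseq hj low; last by lia.
  rewrite ifF; last by rewrite /t; lia.
  rewrite (_ : _ < t.+1); last by rewrite /t; lia.
  rewrite larger_before_cat ifF; last first.
    by apply/mapP => -[x]; rewrite mem_mid /skip; case: ifP; rewrite /t; lia.
  rewrite larger_before_iota ?addn0; last by lia.
  rewrite add1n -[in RHS]size_mid -(size_map (skip t)); congr _.+1.
  apply/eqP; rewrite -all_count; apply/allP => _ /mapP[x + ->].
  by rewrite mem_mid /skip /=; case: ifP; rewrite /t; lia.
rewrite (_ : 1 + a.+1 + b = t.+1) /=; last by rewrite /t; lia.
rewrite low ?eqxx; last by rewrite /t; lia.
congr (_ :: _); rewrite -map_skip_high -map_comp; apply/eq_in_map => v; rewrite mem_iota => hv /=.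
have sv : skip t v = v.+1 by rewrite /skip; case: ifP; lia.
rewrite low; last by rewrite sv /t; lia.
rewrite {1 2}sv ifF; last by lia.
rewrite ltnNge ltnW ?add0n ?larger_before_cat ?ifT; try lia.
  by rewrite larger_before_map //; exact: skip_mono.
by apply: map_f; rewrite mem_mid; lia.
Qed.

Lemma moved_perm : perm_eq moved (t.+1 :: map (skip t) whole).
Proof.
rewrite perm_cons !map_cat.
rewrite (@map_skip_low _ (iota 1 a)); last by apply/allP => x; rewrite mem_iota /t; lia.
rewrite (@map_skip_low _ (iota a.+1 b.+1)); last by apply/allP => x; rewrite mem_iota /t; lia.
rewrite iota_last -catA perm_cat2l /=.
by rewrite perm_sym -[_ :: _]cat1s perm_catCA.
Qed.

Lemma gamma_sandwiched : gamma (size whole - b.+1 + 2) (a + 2) (t.+1 :: map (skip t) whole) = moved.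
Proof.
(* This is the one-based position of [a.+1], after the prepended entry, the prefix [iota 1 a] and
   the [r] entries of [mid]. *)
have -> : size whole - b.+1 + 2 = (a + r).+2.
  by rewrite /whole !size_cat !size_iota size_mid; lia.
rewrite !map_cat.
rewrite (@map_skip_low _ (iota 1 a)); last by apply/allP => x; rewrite mem_iota /t; lia.
rewrite (@map_skip_low _ (iota a.+1 b.+1)); last by apply/allP => x; rewrite mem_iota /t; lia.
rewrite addn2 /gamma /= catA.
set l := iota 1 a ++ map (skip t) mid.
have sl : size l = a + r by rewrite size_cat size_map size_iota size_mid.
have -> : drop (a + r).+1 (l ++ a.+1 :: iota a.+2 b) = iota a.+2 b.
  by rewrite drop_cat sl ifF ?subSnn /= ?drop0 //; lia.
rewrite nth_cat sl ltnn subnn /= [take (a + r) _]take_size_cat //.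
rewrite /l -[(_ ++ _) ++ iota a.+2 b]catA take_size_cat ?size_iota //.
rewrite [drop a _]drop_size_cat ?size_iota //.
by rewrite /moved iota_last -catA.
Qed.

(** Behind the first entry, an increasing run of smallest values precedes a relabelled subsequence
    of [whole]. With [t.+1] as first entry, the increasing order of the values up to [t] excludes
    every pattern but 2413. *)
Lemma moved_evil_avoiding : evil_avoiding whole -> evil_avoiding moved.
Proof.
move=> ev; have skip_mid x : x \in map (skip t) mid -> t.+1 < x.
  by case/mapP => y; rewrite mem_mid /skip => hy ->; case: ifP; lia.
apply: evil_avoiding_cons; last first.
  apply: evil_avoiding_iota_cat.
    rewrite all_cat; apply/andP; split; apply/allP => x; last by rewrite mem_iota; lia.
    by move/skip_mid; rewrite /t; lia.
  have -> : iota a.+2 b = map (skip t) (iota a.+2 b).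
    by rewrite map_skip_low //; apply/allP => x; rewrite mem_iota /t; lia.
  rewrite -map_cat; apply: evil_avoiding_map (skip_mono t) (evil_avoiding_sub _ ev).
  rewrite /whole -[X in subseq X _]cat0s; apply: cat_subseq; first exact: sub0seq.
  by apply: cat_subseq => //=; exact: subseq_cons.
move=> x y z sub; apply/negP => h.
have low : sorted ltn [seq u <- [:: x; y; z] | u <= t].
  apply: (subseq_sorted ltn_trans (s2 := iota 1 (a.+1 + b))); last exact: iota_ltn_sorted.
  have -> : iota 1 (a.+1 + b) = [seq u <- iota 1 a.+1 ++ map (skip t) mid ++ iota a.+2 b | u <= t].
    rewrite !filter_cat iotaD (all_filterP _); last by apply/allP => u; rewrite mem_iota /t; lia.
    rewrite [X in _ ++ X ++ _](_ : _ = [::]).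
      by rewrite (all_filterP _) //; apply/allP => u; rewrite mem_iota /t; lia.
    apply/eqP; rewrite -[_ == _]negbK -has_filter; apply/hasPn => u /skip_mid; lia.
  by rewrite subseq_filter filter_all (subseq_trans (filter_subseq _ _) sub).
move: h; rewrite /evil => /or4P[/and3P[yt tz zx]|h|h|h]; first last.
- by move: low h => /=; do 3?case: ifP; rewrite /=; lia.
- by move: low h => /=; do 3?case: ifP; rewrite /=; lia.
- by move: low h => /=; do 3?case: ifP; rewrite /=; lia.
(* A 2413 would need an entry [y] at most [t] between two entries [x] and [z] above [t.+1], but all
   entries above [t.+1] are consecutive, in the image of [mid]. *)
have in_low u : u \in iota 1 a.+1 -> u <= t by rewrite mem_iota /t; lia.
have in_high u : u \in iota a.+2 b -> u <= t by rewrite mem_iota /t; lia.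
have [[|x1 t1] [t2 [e s1 s2]]] := subseq_catP sub; last first.
  case: e s1 => <- _ /mem_subseq/(_ x); rewrite inE eqxx => /(_ isT) /in_low.
  by lia.
rewrite cat0s in e; move: s2; rewrite -e => /subseq_catP[u1 [u2 [e' v1 v2]]].
have : y \in u1 -> False by move/(mem_subseq v1)/skip_mid; lia.
have : z \in u2 -> False by move/(mem_subseq v2)/in_high; lia.
have : x \in u2 -> False by move/(mem_subseq v2)/in_high; lia.
move: e'; case: u1 {v1} => [|? [|? u1]] /=.
- by move=> <-; rewrite inE eqxx => /(_ isT).
- by case=> _ <- _; rewrite !inE eqxx orbT => /(_ isT).
- by case=> _ <- _ _ _; rewrite !inE eqxx orbT => /(_ isT).
Qed.

End Sandwich.

(** * Recognising sandwiches from the code, and the two cases of psi_q *)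

Lemma psi_qP s (t := smallest_recoil s) :
  (exists a b, sandwiched s a b /\
     psi_q s = gamma (size s - b + 2) (a + 2) (rho t.+1 1 s)) \/
  ((forall a b, ~~ sandwiched s a b) /\ psi_q s = rho t.+1 1 s).
Proof.
rewrite /psi_q -/t; set l := filter _ _.
have ml ab : (ab \in l) = sandwiched s ab.1 ab.2.
  rewrite mem_filter andb_idr //; case: ab => a b /andP[/and3P[b0 _ _] h].
  by apply/allpairsPdep; exists a, b; rewrite !mem_iota; move: b0 h => /=; split=> //; lia.
case: l ml => [|[a b] l] ml; [right | left].
  by split=> // a b; rewrite -(ml (a, b)).
by exists a, b; rewrite -(ml (a, b)) mem_head.
Qed.

Lemma sandwichedE m s a b : is_perm m s -> sandwiched s a b ->
  [/\ 0 < b, a + b <= m & exists2 mid, s = iota 1 a ++ mid ++ iota a.+1 b &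
      perm_eq mid (iota (a + b).+1 (m - (a + b)))].
Proof.
move=> ps /andP[/and3P[b0 /eqP ea /eqP eb]]; rewrite (is_perm_size ps) in eb *.
move=> abm; split=> //; exists (take (m - b - a) (drop a s)).
  rewrite -{1}ea -{1}eb (_ : drop (m - b) s = drop (m - b - a) (drop a s)).
    by rewrite cat_take_drop cat_take_drop.
  by rewrite drop_drop subnK //; lia.
set mid := take _ _.
have es : s = iota 1 a ++ mid ++ iota a.+1 b.
  rewrite -{1}ea -{1}eb (_ : drop (m - b) s = drop (m - b - a) (drop a s)).
    by rewrite cat_take_drop cat_take_drop.
  by rewrite drop_drop subnK //; lia.
have := ps; rewrite /is_perm {1}es -{1}(subnKC abm) -addnA !iotaD perm_cat2l.
rewrite add1n perm_sym perm_catC perm_cat2r perm_sym; congr (perm_eq _ (iota _ _)); lia.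
Qed.

Lemma prefix_of_code a n k (s : seq nat) : perm_eq s (iota k (a + n)) ->
  (forall v, k <= v < k + a -> larger_before v s = 0) ->
  take a s = iota k a /\ (perm_eq (drop a s) (iota (k + a) n)).
Proof.
elim: a k s => [|a IH] k s ps h; first by rewrite take0 drop0 addn0.
have [_ + _] := perm_iota_split ps; rewrite h; last by lia.
case: s ps h => [|x s] ps h; first by move/perm_size: ps.
rewrite /=; case: eqP => // ex _; rewrite {}ex in ps h *.
move: ps; rewrite /= perm_cons => ps.
have [|e1 e2] := IH k.+1 s ps; last by rewrite e1 addnS -addSn.
move=> v hv; rewrite -(h v); last by lia.
case/andP: hv => kv _.
by rewrite larger_before_cons (ltn_eqF kv) (leq_gtF (ltnW kv)).
Qed.

(** The smallest value [k] stands right after [r] entries. Once it is deleted, the next values fill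
    the places from [r] on by induction, so they follow [k] directly. *)
Lemma suffix_of_code b r k (s : seq nat) : perm_eq s (iota k (b + r)) ->
  (forall v, k <= v < k + b -> larger_before v s = r) -> drop r s = iota k b.
Proof.
elim: b k s => [|b IH] k s ps h.
  by apply: drop_oversize; rewrite (perm_size ps) size_iota.
rewrite addSn in ps; have [pr ik es] := perm_iota_split ps.
have ir : index k s = r by rewrite ik h //; lia.
have := IH k.+1 (rem k s) pr; rewrite ir in es => IH'.
rewrite es drop_cat size_take_min; have -> : minn r (size (rem k s)) = r.
  by rewrite (perm_size pr) size_iota; lia.
rewrite ltnn subnn drop0 IH' // => v hv.
by rewrite larger_before_rem ?h //; lia.
Qed.

(** A converse of [code_sandwiched]: the zeros put [1, ..., a] at the front, and the entries [r]
    then push the next [b] values to the end of what is left. *)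
Lemma sandwiched_code m s a b r c2 : is_perm m s -> 0 < b -> m = a + b + r ->
  code s = (nseq a 0 ++ nseq b r) ++ c2 -> sandwiched s a b.
Proof.
move=> ps b0 em ec; have lb v : 0 < v <= a + b -> larger_before v s = if v <= a then 0 else r.
  move=> hv; have := nth_code s v.-1; rewrite (is_perm_size ps) prednK; last by lia.
  have -> : v <= m by lia.
  move=> <-; rewrite ec !nth_cat size_cat !size_nseq !nth_nseq.
  have -> : v.-1 < a + b by lia.
  by do !case: ifP; lia.
have ps' := ps; rewrite /is_perm em -addnA in ps'.
have [|e1 e2] := prefix_of_code ps'.
  by move=> v hv; rewrite lb ?ifT; lia.
rewrite add1n in e2.
have e3 := suffix_of_code e2.
rewrite /sandwiched b0 e1 eqxx (is_perm_size ps) em leq_addr andbT /=.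
rewrite (_ : a + b + r - b = r + a); last by lia.
rewrite -drop_drop e3 // => v hv.
have <- : larger_before v s = r by rewrite lb ?ifF; lia.
rewrite -[in RHS](cat_take_drop a s) larger_before_cat e1 ifF; last by rewrite mem_iota; lia.
by rewrite count_gt0P //; apply/allP => x; rewrite mem_iota; lia.
Qed.

Lemma two_valued_sorted r c : 0 < r -> sorted leq c -> all (fun x => (x == 0) || (x == r)) c ->
  exists a b, c = nseq a 0 ++ nseq b r.
Proof.
move=> r0; elim: c => [|x c IH] /=; first by exists 0, 0.
move=> pc /andP[/orP[/eqP->|/eqP ex] hc].
  have [a [b ->]] := IH (path_sorted pc) hc; by exists a.+1, b.
exists 0, (size c).+1; rewrite /= ex; congr cons; apply/all_pred1P.
apply/allP => y yc; have := allP hc y yc.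
have := allP (order_path_min leq_trans pc) y yc; rewrite ex /=; lia.
Qed.

Lemma sorted_two_nseq p q x y : x <= y -> sorted leq (nseq p x ++ nseq q y).
Proof.
move=> xy; apply/(sortedP 0) => i; rewrite size_cat !size_nseq => hi.
by rewrite !nth_cat !size_nseq !nth_nseq; do !case: ifP; lia.
Qed.

Lemma last_two_nseq p q x y : last 0 (nseq p x ++ nseq q.+1 y) = y.
Proof. by rewrite last_cat /=; elim: q. Qed.

Lemma first_descent_lt m s t A : is_perm m s -> descents (code s) = t :: A -> t < m.
Proof.
move=> ps ed; have td : t \in descents (code s) by rewrite ed mem_head.
by case/andP: (descents_lt (fun j => code_bound j ps) td).
Qed.

(* [t] is the first descent of [c], so [map (subn (m - t)) (take t c)] is the
   first partition attached to [0 :: c], up to its first part [m - t]. *)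
Definition psi2_code (m t : nat) (c c' : seq nat) : Prop :=
  exists2 c1, [/\ c' = c1 ++ 0 :: drop t c, size c1 = t, sorted leq c1 & 0 < last 0 c1] &
    (m - t).+1 :: strip0 (map (subn (m - t).+1) c1) =
    psi2_first (m - t :: strip0 (map (subn (m - t)) (take t c))).

(** The new first block again contributes the single descent [t], and the [0] inserted after it only
    moves the later descents. *)
Lemma psi2_code_Evil m k s s' t A : is_perm m s -> nrecoils s = k ->
    descents (code s) = t :: A -> is_perm m.+1 s' -> evil_avoiding s' ->
    psi2_code m t (code s) (code s') -> Evil m.+1 k s'.
Proof.
move=> ps rk ed ps' ev' [c1 [ec _ srt l0] _]; apply/and3P; split=> //.
have [_ srt1 hl] := descents_consE ed.
rewrite (nrecoilsE ps') ec descents_cat // descents0 /= !size_map -rk (nrecoilsE ps).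
by rewrite -{2}(cat_take_drop t (code s)) descents_cat //= size_map.
Qed.

Lemma psi_q_sandwiched m s t A (c := code s) a b :
    is_perm m s -> evil_avoiding s -> descents c = t :: A ->
    sandwiched s a b -> psi_q s = gamma (size s - b + 2) (a + 2) (rho t.+1 1 s) ->
  [/\ is_perm m.+1 (psi_q s), evil_avoiding (psi_q s) & psi2_code m t c (code (psi_q s))].
Proof.
move=> ps ev ed sw eq.
have [b0 abm [mid es pm]] := sandwichedE ps sw.
case: b b0 abm sw eq es pm => // b _ abm sw eq es pm.
set r := m - _ in pm; have ec := code_sandwiched pm; rewrite -es -/c in ec.
set rest := map _ _ in ec.
have sc1 : size (nseq a 0 ++ nseq b.+1 r) = a + b.+1 by rewrite size_cat !size_nseq.
(* With an empty middle the code would be identically [0] and have no descent. *)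
have r0 : 0 < r.
  rewrite lt0n; apply/eqP => r0; have : t \in descents c by rewrite ed mem_head.
  rewrite mem_descents ec /rest r0 cats0 => /andP[_].
  by rewrite !nth_cat !nth_nseq; do !case: ifP; lia.
have hr : head 0 rest < r.
  have := code_bound (a + b.+1) ps; rewrite -/c ec nth_cat sc1 ltnn subnn nth0; lia.
have tE : t = a + b.+1.
  have := ed; rewrite ec descents_cat ?sorted_two_nseq ?last_two_nseq // sc1.
  by case.
have epsi : psi_q s = (a + b.+1).+1 :: iota 1 a.+1 ++ map (skip (a + b.+1)) mid ++ iota a.+2 b.
  by rewrite eq rho_skip tE es (gamma_sandwiched pm).
have ecq := code_moved pm; rewrite -epsi -/rest in ecq.
have dc : drop t c = rest by rewrite ec drop_size_cat // sc1.
have tc : take t c = nseq a 0 ++ nseq b.+1 r by rewrite ec take_size_cat // sc1.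
have srt : sorted leq (nseq a.+1 1 ++ nseq b r.+1) by exact: sorted_two_nseq.
have l0 : 0 < last 0 (nseq a.+1 1 ++ nseq b r.+1).
  case: (b) => [|b']; last by rewrite last_two_nseq.
  by rewrite cats0 -[nseq _ _]cat0s (last_two_nseq 0 a 0 1).
split.
- by rewrite epsi /is_perm (perm_trans (moved_perm pm)) // -es; exact: rho_perm.
- by rewrite epsi; apply: (moved_evil_avoiding pm); rewrite -es.
exists (nseq a.+1 1 ++ nseq b r.+1).
  by rewrite dc; split=> //; rewrite size_cat !size_nseq tE; lia.
(* The first partition of [0 :: c] is [r] repeated [a.+1] times, so [psi2_first] takes its branch
   for equal parts; the new block yields [r.+1] followed by [a.+1] copies of [r]. *)
rewrite tc (_ : m - t = r); last by rewrite /r tE.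
rewrite !map_cat !map_nseq subnn subSS !subn0 subnn !strip0_nseq_cat ?strip0_nseq0 ?cats0; try lia.
by rewrite /= ifT //; apply/allP => x /nseqP[-> _].
Qed.

(** Block entries and the amount they are subtracted from both grow by one, so only the first part
    changes, as in the second branch of [psi2_first]. The branch for equal parts would force a block
    with values [0] and [m - t] only, hence a sandwich. *)
Lemma psi_q_not_sandwiched m s t A (c := code s) :
    is_perm m s -> evil_avoiding s -> descents c = t :: A ->
    (forall a b, ~~ sandwiched s a b) -> psi_q s = rho t.+1 1 s ->
  [/\ is_perm m.+1 (psi_q s), evil_avoiding (psi_q s) & psi2_code m t c (code (psi_q s))].
Proof.
move=> ps ev ed nsw ->; rewrite rho_skip.
have [/andP[t0 tc] srt1 hl] := descents_consE ed.
have tm := first_descent_lt ps ed.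
have st : size (take t c) = t by rewrite size_takel.
have ec := code_rho tm ps; rewrite -/c in ec.
have srt : sorted leq (map succn (take t c)) by rewrite sorted_map.
have l0 : 0 < last 0 (map succn (take t c)).
  by rewrite -nth_last size_map (nth_map 0) // st prednK.
split; first exact: rho_perm (ltnW tm) ps.
  by apply: (rho_evil_avoiding ps ev); rewrite (recoilsE ps) ed.
exists (map succn (take t c)); first by rewrite size_map.
rewrite -map_comp (eq_map (g := subn (m - t))) //=; case: ifP => // hall.
have two : all (fun x => (x == 0) || (x == m - t)) (take t c).
  apply/(all_nthP 0) => j; rewrite st => hj.
  have bj : nth 0 (take t c) j <= m - t.
    have /= := sorted_leq_nth leq_trans leqnn 0 srt1 j t.-1.
    rewrite !inE st hj prednK // leqnn -ltnS prednK // hj => /(_ isT isT isT).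
    by move=> h; apply: leq_trans h _; rewrite nth_take ?prednK //; have := code_bound t.-1 ps; rewrite prednK.
  have := nth_strip0 (map (subn (m - t)) (take t c)) j.
  rewrite (nth_map 0) ?st //.
  (* A surviving coordinate equals [m - t], so the block entry is [0]; a stripped one is [0], so the
     entry is [m - t]. *)
  case: (ltnP j (size (strip0 (map (subn (m - t)) (take t c))))) => hjs.
    by have /eqP -> := all_nthP 0 hall j hjs; lia.
  by rewrite nth_default //; lia.
have [|a [b eab]] := two_valued_sorted _ srt1 two; first by lia.
(* The block ends in a descent, so its last entry is positive. *)
have b0 : 0 < b.
  case: b eab => // eab; move: hl; rewrite -/c eab cats0.
  by have -> : last 0 (nseq a 0) = 0 by elim: (a).
have tab : t = a + b by rewrite -st eab size_cat !size_nseq.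
have := nsw a b; rewrite (@sandwiched_code m s a b (m - t) (drop t c)) //; first by lia.
by rewrite -eab cat_take_drop.
Qed.

Lemma psi_q_code m s t A (c := code s) :
    is_perm m s -> evil_avoiding s -> descents c = t :: A ->
  [/\ is_perm m.+1 (psi_q s), evil_avoiding (psi_q s) & psi2_code m t c (code (psi_q s))].
Proof.
move=> ps ev ed; have := psi_qP s; rewrite /smallest_recoil (recoilsE ps) ed [head 0 _]/=.
case=> [[a [b [sw eq]]]|[nsw eq]]; first exact: psi_q_sandwiched ps ev ed sw eq.
exact: psi_q_not_sandwiched ps ev ed nsw eq.
Qed.

Lemma psi_q_parts m k s : 0 < k -> Evil m k s ->
  psi_q s = f_inv (P_inv (m + 2) k (Psi2 (Pmap (f s)))).
Proof.
move=> k0 ev; have /and3P[ps av /eqP rk] := ev.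
case ed : (descents (code s)) => [|t A].
  by move: rk k0; rewrite (nrecoilsE ps) ed => <-.
have [ps' av' cq] := psi_q_code ps av ed.
have ev' := psi2_code_Evil ps rk ed ps' av' cq; have [c1 [ec s1 srt l0] eP] := cq.
have [/andP[t0 tc] srt1 hl] := descents_consE ed.
have tm := first_descent_lt ps ed.
have st : size (take t (code s)) = t by rewrite size_takel.
rewrite addn2; apply: f_inv_P_inv ev' _; rewrite ec (Pmap_f ev) -{2}(cat_take_drop t (code s)).
rewrite (@code_parts_dup_tail m.+1 (take t (code s))) ?st //; first last.
- by rewrite cat_take_drop => j; exact: code_bound0.
rewrite code_parts_first_block // ?st //.
by rewrite subSS subSn ?(ltnW tm) // eP [Psi2 _]/= [behead _]/=.
Qed.

Theorem theorem5p16 :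
  (forall (m k : nat) (pi : seq nat), 1 <= m -> 1 <= k -> Evil m k pi ->
     psi_p pi = f_inv (P_inv (m + 2) k (Psi1 (Pmap (f pi))))) /\
  (forall (m k : nat) (pi : seq nat), 1 <= m -> 1 <= k -> Evil m k pi ->
     psi_q pi = f_inv (P_inv (m + 2) k (Psi2 (Pmap (f pi))))) /\
  (forall (k n i : nat) (pi : seq nat), 1 <= k -> k + 1 <= i -> i <= n - 1 ->
     Evil (i - 1) (k - 1) pi ->
     psi_ikn i k n pi = f_inv (P_inv n k (Phi i k n (Pmap (f pi))))).
Proof.
split; [|split] => *; [exact: psi_p_parts | exact: psi_q_parts | exact: psi_ikn_parts].
Qed.
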